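(* Let $(M,g)$ be a $(q+r)$-dimensional Riemannian manifold, $\alpha$ a semi-calibration $q$-form on $M$ satisfying the equality property for some $\chi\in\Omega^q(M,E)$, and $H$ a $q$-dimensional distribution calibrated, thus oriented, by $\alpha$. \begin{enumerate} \item If $\pi\in G_H(q,M)$ and $\{v_i\}_{i=1}^q$ is a basis of $\pi$, then, with $\vec v=v_1\wedge\cdots\wedge v_q$, $$\alpha_0(\vec v)\,\alpha_2(\vec v)+\tfrac12|\chi_1(\vec v)|^2=|\mathrm{vol}^H_\pi(\vec v)|^2\cdot ve_1(\pi).$$ \item If $\pi\in G_H^+(q,M)$ and $\{v_i\}_{i=1}^q$ is a positive orthonormal basis of $(\pi,g^H_\pi)$, then $$\alpha_2(\vec v)+\tfrac12|\chi_1(\vec v)|^2=ve_1(\pi).$$ Hence equality holds in the inequality $\alpha_2|_\pi\le ve(\pi)\,\mathrm{vol}^H_\pi$ if and only if $\chi_1|_\pi=0$. \end{enumerate}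
   Context: $G(q,M)$ is the Grassmannian bundle of oriented $q$-planes in tangent spaces of $M$; for $\pi\in G(q,M)$, $\mathrm{vol}_\pi$ is the volume form on $\pi$ induced by its orientation and $g$. A $q$-form $\alpha$ is a semi-calibration if $\alpha|_\pi\le\mathrm{vol}_\pi$ for all $\pi\in G(q,M)$. It satisfies the equality property for $\chi$ if $\chi$ is a $q$-form with values in a Riemannian vector bundle $(E,g_E)$ over $M$ and $|\alpha(v_1,\dots,v_q)|^2+|\chi(v_1,\dots,v_q)|^2=|v_1\wedge\dots\wedge v_q|^2$ for each $\pi\in G(q,M)$ and frame $v_1,\dots,v_q$ of $\pi$. $H$ is calibrated by $\alpha$ if every $H_x$ carries an orientation with $\alpha|_{H_x}=\mathrm{vol}_{H_x}$; $H$ is given this orientation. Let $V=H^\perp$, with projections $p_H,p_V$ from $TM=H\oplus V$. Decompose $\alpha=\sum_{i=0}^q\alpha_i$, $\alpha_i\in\Gamma(\Lambda^{q-i}H^*\otimes\Lambda^iV^* )$, and $\chi=\sum_{i=0}^q\chi_i$, $\chi_i\in\Gamma(E\otimes\Lambda^{q-i}H^*\otimes\Lambda^iV^* )$; components with index $i>q$ are $0$. For $\vec v=v_1\wedge\cdots\wedge v_q$, write $\alpha_i(\vec v)=\alpha_i(v_1,\dots,v_q)$, and similarly for $\chi_i$ and $\mathrm{vol}^H_\pi$. $G_H(q,M)$ is the set of $\pi\in G(q,M)$, $\pi\subseteq T_xM$, with $p_H|_\pi:\pi\to H_x$ injective; $G_H^+(q,M)$ is the subset where $p_H|_\pi$ is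 an orientation-preserving isomorphism. For $\pi\in G_H(q,M)$, $g^H_\pi:=(p_H|_\pi)^*g$, $\mathrm{vol}^H_\pi$ is the volume form on the oriented space $\pi$ defined by $g^H_\pi$, and $ve_1(\pi)=ve(\pi)=\frac12\sum_{i}|p_V(w_i)|_g^2$ for any orthonormal basis $\{w_i\}$ of $(\pi,g^H_\pi)$. *)

(* Defs.v *)
From HB Require Import structures.
From mathcomp Require Import all_boot all_order all_algebra.
From mathcomp Require Import all_classical all_reals all_analysis.

Set Implicit Arguments.
Unset Strict Implicit.
Unset Printing Implicit Defensive.

Import Order.TTheory GRing.Theory Num.Theory.
Import numFieldNormedType.Exports.

Local Open Scope classical_set_scope.
Local Open Scope ring_scope.

(* Vectors are row vectors, a q-tuple of vectors of R^n is the q x n matrix   *)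
(* of its rows, a linear subspace of R^n is the row space of a matrix, and    *)
(* linear maps act on the right.                                              *)

Fixpoint Ck (R : realType) (n k : nat) (U : set 'rV[R]_n) (f : 'rV[R]_n -> R)
  : Prop :=
  (forall x, U x -> {for x, continuous f}) /\
  (if k is k'.+1 then
     forall a : 'I_n,
       (forall x, U x -> derivable f x (delta_mx 0 a)) /\
       Ck k' U (fun x => 'D_(delta_mx 0 a) f x)
   else True).

Definition smooth_on (R : realType) n (U : set 'rV[R]_n) (f : 'rV[R]_n -> R) :=
  forall k, Ck k U f.

(* [ch_inv c] is only meaningful on the image of [ch_dom c].                  *)
Record manifold (R : realType) (n : nat) := Manifold {
  mf_sort :> topologicalType;
  mf_hausdorff : hausdorff_space mf_sort;
  mf_countable : @second_countable mf_sort;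
  chart : Type;
  ch_dom : chart -> set mf_sort;
  ch_map : chart -> mf_sort -> 'rV[R]_n;
  ch_inv : chart -> 'rV[R]_n -> mf_sort;
  ch_dom_open : forall c, open (ch_dom c);
  ch_img_open : forall c, open (ch_map c @` ch_dom c);
  ch_mapK : forall c x, ch_dom c x -> ch_inv c (ch_map c x) = x;
  ch_map_cont : forall c x, ch_dom c x -> {for x, continuous (ch_map c)};
  ch_inv_cont : forall c y, (ch_map c @` ch_dom c) y ->
    {for y, continuous (ch_inv c)};
  ch_smooth : forall c d (b : 'I_n),
    smooth_on (ch_map c @` (ch_dom c `&` ch_dom d))
      (fun y => ch_map d (ch_inv c y) 0 b);
  (* a distinguished chart around each point *)
  ch_at : mf_sort -> chart;
  ch_atP : forall x, ch_dom (ch_at x) x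
}.

Definition smooth_fun (R : realType) n (M : manifold R n)
    (U : set M) (f : M -> R) :=
  forall c : chart M, smooth_on (ch_map c @` (U `&` ch_dom c)) (f \o ch_inv c).

(* The tangent space T_xM is identified with R^n by means of the chart        *)
(* [ch_at x]; [tangent_change c d x] is the coordinate change of T_xM from    *)
(* the chart c to the chart d.  In particular the rows of                     *)
(* [coord_frame c x] are the coordinate vectors of c at x, and the rows of    *)
(* [X *m tangent_coord c x] are the c-coordinates of the rows of X.           *)
Definition tangent_change (R : realType) n (M : manifold R n) (c d : chart M)
    (x : M) : 'M[R]_n :=
  jacobian (ch_map d \o ch_inv c) (ch_map c x).

Definition coord_frame (R : realType) n (M : manifold R n) (c : chart M)
    (x : M) : 'M[R]_n := tangent_change c (ch_at x) x.

Definition tangent_coord (R : realType) n (M : manifold R n) (c : chart M)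
    (x : M) : 'M[R]_n := tangent_change (ch_at x) c x.

Section InnerProduct.
Variables (R : realType) (n : nat).
Implicit Type G : 'M[R]_n.

(* inner products are given by their Gram matrix *)
Definition inner_product G :=
  G^T = G /\ forall u : 'rV[R]_n, u != 0 -> 0 < (u *m G *m u^T) 0 0.

Definition sqnorm G (u : 'rV[R]_n) : R := (u *m G *m u^T) 0 0.

Definition gram G q (v : 'M[R]_(q, n)) : 'M[R]_q := v *m G *m v^T.

(* | v_1 /\ ... /\ v_q |^2 *)
Definition wedge_sqnorm G q (v : 'M[R]_(q, n)) : R := \det (gram G v).

Definition orth_compl G (A : 'M[R]_n) : 'M[R]_n := kermx (G *m A^T).

End InnerProduct.

Record riemannian_metric (R : realType) n (M : manifold R n) := RiemMetric {
  rm_gram :> M -> 'M[R]_n;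
  rm_inner : forall x, inner_product (rm_gram x);
  rm_smooth : forall (c : chart M) (a b : 'I_n),
    smooth_fun (ch_dom c) (fun x => gram (rm_gram x) (coord_frame c x) a b)
}.

(* A vector bundle of rank k, given by a smooth cocycle; its fibre at x is    *)
(* identified with R^k by means of the trivialization [tr_at x].              *)
Record vector_bundle (R : realType) n (M : manifold R n) (k : nat) :=
  VectorBundle {
  triv : Type;
  tr_dom : triv -> set M;
  tr_dom_open : forall i, open (tr_dom i);
  tr_change : triv -> triv -> M -> 'M[R]_k;
  tr_change1 : forall i x, tr_dom i x -> tr_change i i x = 1%:M;
  tr_changeM : forall i j l x, tr_dom i x -> tr_dom j x -> tr_dom l x ->
    tr_change i j x *m tr_change j l x = tr_change i l x;
  tr_change_smooth : forall i j (a b : 'I_k),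
    smooth_fun (tr_dom i `&` tr_dom j) (fun x => tr_change i j x a b);
  tr_at : M -> triv;
  tr_atP : forall x, tr_dom (tr_at x) x
}.

Record bundle_metric (R : realType) n (M : manifold R n) k
    (E : vector_bundle M k) := BundleMetric {
  bm_gram :> M -> 'M[R]_k;
  bm_inner : forall x, inner_product (bm_gram x);
  bm_smooth : forall (i : triv E) (a b : 'I_k),
    smooth_fun (tr_dom i)
      (fun x => gram (bm_gram x) (tr_change i (tr_at E x) x) a b)
}.

(* Same formulation as determinant_multilinear and determinant_alternate.     *)
Definition alternating (R : realType) n q (W : lmodType R)
    (f : 'M[R]_(q, n) -> W) :=
  (forall (A B C : 'M[R]_(q, n)) (i : 'I_q) (b c : R),
     row i A = b *: row i B + c *: row i C ->
     row' i B = row' i A -> row' i C = row' i A ->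
     f A = b *: f B + c *: f C) /\
  (forall (A : 'M[R]_(q, n)) (i j : 'I_q),
     i != j -> row i A = row j A -> f A = 0).

Record diff_form (R : realType) n (M : manifold R n) (q : nat) := DiffForm {
  df_val :> M -> 'M[R]_(q, n) -> R;
  df_alt : forall x, alternating (df_val x : _ -> R^o);
  df_smooth : forall (c : chart M) (a : 'I_q -> 'I_n),
    smooth_fun (ch_dom c) (fun x => df_val x (rowsub a (coord_frame c x)))
}.

Record bundle_form (R : realType) n (M : manifold R n) k
    (E : vector_bundle M k) (q : nat) := BundleForm {
  bf_val :> M -> 'M[R]_(q, n) -> 'rV[R]_k;
  bf_alt : forall x, alternating (bf_val x);
  bf_smooth : forall (c : chart M) (i : triv E) (a : 'I_q -> 'I_n) (b : 'I_k),
    smooth_fun (ch_dom c `&` tr_dom i)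
      (fun x => (bf_val x (rowsub a (coord_frame c x))
                   *m tr_change (tr_at E x) i x) 0 b)
}.

Record smooth_distribution (R : realType) n (M : manifold R n) (q : nat) :=
  SmoothDistribution {
  ds_space :> M -> 'M[R]_n;
  ds_rank : forall x, \rank (ds_space x) = q;
  ds_smooth : forall x0 : M, exists (U : set M) (X : M -> 'M[R]_(q, n)),
    [/\ open U, U x0,
        forall (c : chart M) (a : 'I_q) (b : 'I_n),
          smooth_fun (U `&` ch_dom c) (fun x => (X x *m tangent_coord c x) a b)
      & forall x, U x -> (X x == ds_space x)%MS]
}.

Section OrientedPlane.
Variables (R : realType) (n : nat).

Definition frame (A : 'M[R]_n) q (u : 'M[R]_(q, n)) : bool := (u == A)%MS.

(* An orientation of a q-dimensional subspace A; its values outside the       *)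
(* frames of A are irrelevant.                                                *)
Record orientation (q : nat) (A : 'M[R]_n) := Orientation {
  or_pos :> pred 'M[R]_(q, n);
  or_posM : forall (P : 'M[R]_q) (u : 'M[R]_(q, n)),
    frame A u -> P \in unitmx -> or_pos (P *m u) = (or_pos u == (0 < \det P))
}.

Record oriented_plane (q : nat) := OrientedPlane {
  op_space :> 'M[R]_n;
  op_rank : \rank op_space = q;
  op_or : orientation q op_space
}.

Definition positive_frame q (A : 'M[R]_n) (o : orientation q A)
    (u : 'M[R]_(q, n)) : bool := frame A u && o u.

Definition orthonormal_basis q (G A : 'M[R]_n) (w : 'M[R]_(q, n)) : bool :=
  frame A w && (gram G w == 1%:M).

(* The volume form of the oriented subspace A with the inner product induced  *)
(* by G, on vectors u_1, ..., u_q of A; the Gram determinant vanishes unless  *)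
(* they form a frame.                                                         *)
Definition volume_form q (G A : 'M[R]_n) (o : orientation q A)
    (u : 'M[R]_(q, n)) : R :=
  (if o u then 1 else -1) * Num.sqrt (wedge_sqnorm G u).

End OrientedPlane.

Section Geometry.
Variables (R : realType) (n : nat) (M : manifold R n) (g : riemannian_metric M).
Variable q : nat.

Definition semi_calibration (alpha : diff_form M q) :=
  forall (x : M) (pi : oriented_plane R n q) (v : 'M[R]_(q, n)),
    positive_frame (op_or pi) v -> alpha x v <= volume_form (g x) (op_or pi) v.

Definition equality_property k (E : vector_bundle M k) (gE : bundle_metric E)
    (alpha : diff_form M q) (chi : bundle_form E q) :=
  forall (x : M) (pi : oriented_plane R n q) (v : 'M[R]_(q, n)),
    frame pi v ->
    alpha x v ^+ 2 + sqnorm (gE x) (chi x v) = wedge_sqnorm (g x) v.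

(* H is calibrated by alpha, with the orientation o *)
Definition calibrated (alpha : diff_form M q) (H : smooth_distribution M q)
    (o : forall x, orientation q (H x)) :=
  forall (x : M) (v : 'M[R]_(q, n)), (v <= H x)%MS ->
    alpha x v = volume_form (g x) (o x) v.

Variable H : smooth_distribution M q.

Definition vert (x : M) : 'M[R]_n := orth_compl (g x) (H x).
Definition projH (x : M) : 'M[R]_n := proj_mx (H x) (vert x).
Definition projV (x : M) : 'M[R]_n := proj_mx (vert x) (H x).

(* q-forms on T_xM belonging to Lambda^(q-i) H_x^* (x) Lambda^i V_x^*:        *)
(* they vanish on vectors of H_x and V_x unless exactly i of these are        *)
(* taken in V_x.                                                              *)
Definition bidegree (W : lmodType R) (x : M) (i : nat)
    (f : 'M[R]_(q, n) -> W) :=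
  forall (S : {set 'I_q}) (v : 'M[R]_(q, n)),
    (forall j, (row j v <= if j \in S then vert x else H x)%MS) ->
    #|S| <> i -> f v = 0.

Definition hv_decomposition (alpha : diff_form M q)
    (alpha_ : nat -> diff_form M q) :=
  [/\ forall i x, bidegree x i (alpha_ i x : _ -> R^o),
      forall i x v, (q < i)%N -> alpha_ i x v = 0
    & forall x v, alpha x v = \sum_(i < q.+1) alpha_ i x v].

Definition hv_decomposition_bundle k (E : vector_bundle M k)
    (chi : bundle_form E q) (chi_ : nat -> bundle_form E q) :=
  [/\ forall i x, bidegree x i (chi_ i x),
      forall i x v, (q < i)%N -> chi_ i x v = 0
    & forall x v, chi x v = \sum_(i < q.+1) chi_ i x v].

(* pi in G_H(q, M), for a plane pi of T_xM *)
Definition inGH (x : M) (pi : oriented_plane R n q) :=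
  forall u v : 'rV[R]_n, (u <= pi)%MS -> (v <= pi)%MS ->
    u *m projH x = v *m projH x -> u = v.

(* pi in G_H^+(q, M) *)
Definition inGHplus (o : forall x, orientation q (H x))
    (x : M) (pi : oriented_plane R n q) :=
  [/\ inGH x pi, (pi *m projH x == H x)%MS
    & forall u : 'M[R]_(q, n), positive_frame (op_or pi) u ->
        positive_frame (o x) (u *m projH x)].

(* the Gram matrix of p_H^* g *)
Definition gH (x : M) : 'M[R]_n := gram (g x) (projH x).

Definition volH (x : M) (pi : oriented_plane R n q) (v : 'M[R]_(q, n)) : R :=
  volume_form (gH x) (op_or pi) v.

Definition vertical_energy (x : M) (w : 'M[R]_(q, n)) : R :=
  2^-1 * \sum_i sqnorm (g x) (row i w *m projV x).

(* [ve x pi] does not depend on the orthonormal basis picked: see ve_basis    *)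
Definition ve (x : M) (pi : oriented_plane R n q) : R :=
  vertical_energy x (xget 0 [set w | orthonormal_basis (gH x) pi w]).

Lemma ve_basis (x : M) (pi : oriented_plane R n q) (w : 'M[R]_(q, n)) :
  orthonormal_basis (gH x) pi w -> ve x pi = vertical_energy x w.
Proof.
have energyE (u : 'M[R]_(q, n)) :
    vertical_energy x u = 2^-1 * \tr (u *m (gram (g x) (projV x) *m u^T)).
  have -> : u *m (gram (g x) (projV x) *m u^T)
          = u *m projV x *m g x *m (u *m projV x)^T.
    by rewrite /gram (trmx_mul u); move: (projV x) => p; rewrite !mulmxA.
  rewrite /vertical_energy /mxtrace; congr (_ * _); apply: eq_bigr => i _.
  rewrite /sqnorm -!row_mul mxE mxE [RHS]mxE; apply: eq_bigr => j _.
  by rewrite ![trmx _ _ _]mxE [row _ _ _ _]mxE.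
move=> hw; rewrite /ve; set w' := xget _ _.
have : orthonormal_basis (gH x) pi w'.
  by apply: (@xgetI _ 0 [set w | orthonormal_basis (gH x) pi w] w).
case/andP: hw => /eqmxP hw /eqP ow /andP[/eqmxP hw' /eqP].
have [P ->] : exists P, w' = P *m w by apply/submxP; rewrite hw' hw.
have -> : gram (gH x) (P *m w) = P *m gram (gH x) w *m P^T.
  by move: (gH x) => G; rewrite /gram trmx_mul !mulmxA.
rewrite ow mulmx1 => /mulmx1C PTP; rewrite !energyE; congr (_ * _).
move: (gram _ _) => K; rewrite trmx_mul -mulmxA mxtrace_mulC -!mulmxA PTP.
by rewrite mulmx1.
Qed.

End Geometry.

(* Main.v *)
Require Import Defs.
From HB Require Import structures.
From mathcomp Require Import all_boot all_order all_algebra.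
From mathcomp Require Import all_classical all_reals all_analysis.
From mathcomp Require Import ring lra zify.
Import Order.TTheory GRing.Theory Num.Theory.
Local Open Scope ring_scope.

(** The statement is pointwise, and its identity is a second-order Taylor
    coefficient of the equality property.  Let [v] be a frame of [pi], with
    horizontal part [h] and vertical part [w], and tilt it: [v_t = h + t *: w].
    Since [h] is independent, so is [v_t], and the equality property gives, for
    every [t],
      [alpha(v_t) ^+ 2 + |chi(v_t)| ^+ 2 = |v_t| ^+ 2],
    where [|v_t|] is the norm of the wedge product.  Both sides are polynomials
    in [t].

    On the left, a form of bidegree [(q - i, i)] takes the value
    [t ^+ i * alpha_i(v)] on [v_t] ([bidegree_scale]).  On the right, horizontal
    and vertical vectors are orthogonal, so the Gram matrix of [v_t] is
    [gram h + t ^+ 2 *: gram w], and the derivative of the determinant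
    ([det_1DZ]) gives the expansion [D + t ^+ 2 * (D * (2 * ve)) + ...] with
    [D = |volH v| ^+ 2] ([wedge_sqnorm_expansion]).

    Calibration says [alpha_0(v) ^+ 2 = D], so degree 0 forces [chi_0(v) = 0],
    then degree 1 forces [alpha_1(v) = 0], and degree 2 is the double of the
    identity of part 1 ([second_order_identity]).

    For part 2, if the projection preserves orientation then [alpha_0] and
    [volH] agree on [pi] ([component0_positive], [component0_frame]); dividing
    by [volH v] gives the inequality, whose defect is a positive multiple of
    [|chi_1(v)| ^+ 2].  On dependent vectors of [pi] all the forms vanish
    ([alternating_dependent]), so only frames matter for the equality case. *)

Set Implicit Arguments.
Unset Strict Implicit.
Unset Printing Implicit Defensive.

(** * Alternating forms *)

Section Multilinear.
Variables (R : realType) (n q : nat) (W : lmodType R) (f : 'M[R]_(q, n) -> W).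
Hypothesis f_alt : Defs.alternating f.

Let set_row (i : 'I_q) (u : 'rV[R]_n) (v : 'M[R]_(q, n)) : 'M[R]_(q, n) :=
  \matrix_j (if j == i then u else row j v).

Let row_set_row i j u v :
  row j (set_row i u v) = if j == i then u else row j v.
Proof. by rewrite rowK. Qed.

Let row'_set_row i u u' v :
  row' i (set_row i u v) = row' i (set_row i u' v).
Proof.
apply/row_matrixP => j; rewrite !row_rowsub !row_set_row.
by rewrite eq_sym (negPf (neq_lift i j)).
Qed.

Let set_row_lin i b c u w v :
  f (set_row i (b *: u + c *: w) v)
  = b *: f (set_row i u v) + c *: f (set_row i w v).
Proof.
apply: (f_alt.1 _ _ _ i); rewrite ?row_set_row ?eqxx //;
  exact: row'_set_row.
Qed.

Let set_row_sum i (I : finType) (c : I -> R) (u : I -> 'rV[R]_n) v :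
  f (set_row i (\sum_j c j *: u j) v) = \sum_j c j *: f (set_row i (u j) v).
Proof.
elim/big_rec2: _ => [|j y x _ IH].
  by have := set_row_lin i 0 0 0 0 v; rewrite !scale0r !addr0.
have := set_row_lin i (c j) 1 (u j) x v.
by rewrite !scale1r IH.
Qed.

(** If [c *m v = 0] with [c 0 i != 0], inserting [c *m v] in the slot [i] gives
    both [0] and, all other terms having a repeated row, [c 0 i *: f v]. *)
Lemma alternating_dependent (v : 'M[R]_(q, n)) : ~~ row_free v -> f v = 0.
Proof.
rewrite -kermx_eq0 => /rowV0Pn[c /sub_kermxP cv c0].
have [i ci] : exists i, c 0 i != 0.
  apply/existsP; apply: contraNT c0 => /existsPn c0.
  apply/eqP/rowP => i; rewrite mxE; apply/eqP; move: (c0 i).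
  by rewrite negbK.
have := set_row_sum i (c 0) (fun j => row j v) v.
rewrite -mulmx_sum_row cv (bigD1 i) //= big1 => [|j ji]; last first.
  rewrite (f_alt.2 _ i j) ?scaler0 // 1?eq_sym //.
  by rewrite !row_set_row eqxx (negPf ji).
have := set_row_lin i 0 0 0 0 v; rewrite !scale0r !addr0 => ->.
have -> : set_row i (row i v) v = v.
  by apply/row_matrixP => j; rewrite row_set_row; case: eqP => [->|].
by move/eqP; rewrite eq_sym scaler_eq0 (negPf ci) => /eqP.
Qed.

(** Expanding all slots at once would give a sum over the [2 ^ q] ways of
    choosing [h] or [t *: w] in each slot, where only those with [i] choices of
    [w] survive.  Expanding one slot at a time avoids that sum: both sides
    satisfy the same recursion, so an induction on the number of slots that are
    still mixed suffices. *)
Lemma multilinear_homogeneous (A B : 'M[R]_n) (i : nat)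
    (h w : 'M[R]_(q, n)) (t : R) :
  (forall (S : {set 'I_q}) (v : 'M[R]_(q, n)),
     (forall j, (row j v <= if j \in S then B else A)%MS) ->
     #|S| <> i -> f v = 0) ->
  (h <= A)%MS -> (w <= B)%MS ->
  f (h + t *: w) = t ^+ i *: f (h + w).
Proof.
move=> f_bidegree hA wB.
(* The slots of S carry w, the other slots of T carry h, the rest is mixed;
   the slots of S have already contributed their factor t. *)
pose mix (S T : {set 'I_q}) (s : R) : 'M[R]_(q, n) := \matrix_j
  (if j \in S then row j w else if j \in T then row j h
   else row j h + s *: row j w).
suff mixE m (S T : {set 'I_q}) :
    #|~: (S :|: T)| = m ->
    t ^+ #|S| *: f (mix S T t) = t ^+ i *: f (mix S T 1).
  have mix0 s : mix finset.set0 finset.set0 s = h + s *: w.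
    by apply/row_matrixP => j; rewrite rowK !inE linearD linearZ.
  have := mixE _ finset.set0 finset.set0; rewrite cards0 scale1r !mix0.
  by rewrite scale1r => /(_ _ erefl).
elim: m S T => [|m IH] S T cST.
  have ST j : (j \in S) || (j \in T).
    move/eqP: cST; rewrite cards_eq0 => /eqP/finset.setP/(_ j).
    by rewrite !inE => /negbT; rewrite negbK.
  have mixt : mix S T t = mix S T 1.
    apply/row_matrixP => j; rewrite !rowK; case: ifP => // jS.
    by move: (ST j); rewrite jS /= => ->.
  (* With #|S| <> i both sides vanish. *)
  rewrite mixt; have [->//|/eqP Si] := eqVneq #|S| i.
  rewrite (f_bidegree S) ?scaler0 // => j; rewrite rowK.
  case: ifP => jS; first exact: submx_trans (row_sub _ _) wB.
  by move: (ST j); rewrite jS /= => ->; apply: submx_trans (row_sub _ _) hA.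
have [j jST] : exists j, j \in ~: (S :|: T).
  by apply/finset.set0Pn; rewrite -cards_eq0 cST.
move: (jST); rewrite !inE negb_or => /andP[jS jT].
have mixD s : f (mix S T s) = f (mix S (j |: T) s) + s *: f (mix (j |: S) T s).
  rewrite -[X in X + _]scale1r; apply: (f_alt.1 _ _ _ j).
  - by rewrite !rowK !inE eqxx (negPf jS) (negPf jT) scale1r.
  - apply/row_matrixP => l; rewrite !row_rowsub !rowK !inE.
    by rewrite eq_sym (negPf (neq_lift j l)).
  - apply/row_matrixP => l; rewrite !row_rowsub !rowK !inE.
    by rewrite eq_sym (negPf (neq_lift j l)).
rewrite !mixD !scalerDr; congr (_ + _).
- apply: IH.
  have -> : ~: (S :|: (j |: T)) = ~: (S :|: T) :\ j.
    by apply/finset.setP => l; rewrite !inE; case: (l == j); rewrite ?orbT.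
  by have := cardsD1 j (~: (S :|: T)); rewrite jST cST => -[].
- rewrite scale1r scalerA -exprSr; have <- : #|j |: S| = #|S|.+1.
    by rewrite cardsU1 jS.
  apply: IH.
  have -> : ~: ((j |: S) :|: T) = ~: (S :|: T) :\ j.
    by apply/finset.setP => l; rewrite !inE; case: (l == j).
  by have := cardsD1 j (~: (S :|: T)); rewrite jST cST => -[].
Qed.

End Multilinear.

(** * Second-order Taylor coefficients *)

Lemma horner_eq0_poly (R : numDomainType) (p : {poly R}) :
  (forall t, p.[t] = 0) -> p = 0.
Proof.
move=> p0.
apply: (@roots_geq_poly_eq0 _ p [seq j%:R | j <- iota 0 (size p)]).
- by apply/allP => _ /mapP[j _ ->]; apply/eqP/p0.
- rewrite map_inj_uniq ?iota_uniq // => a b /eqP.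
  by rewrite eqr_nat => /eqP.
- by rewrite size_map size_iota.
Qed.

(** The derivative of the determinant at the identity is the trace.  It is read
    off the two leading coefficients of the characteristic polynomial of [- K],
    which is [s |-> \det (1%:M + s *: K)] with its coefficients reversed. *)
Lemma det_1DZ (R : fieldType) m (K : 'M[R]_m) : exists p : {poly R},
  forall s, \det (1%:M + s *: K) = 1 + s * \tr K + s ^+ 2 * p.[s].
Proof.
case: m K => [|m] K.
  exists 0 => s; rewrite /mxtrace big_ord0 horner0 det_mx00; ring.
pose c := char_poly (- K).
exists (\sum_(i < m) c`_i *: 'X^(m.-1 - i)) => s.
have [->|s0] := eqVneq s 0; first by rewrite scale0r addr0 det1; ring.
have -> : 1%:M + s *: K = s *: (s^-1%:M - - K).
  by rewrite opprK scalerDr -(scalemx1 _ s^-1) scalerA mulfV // scale1r.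
have -> : \det (s *: (s^-1%:M - - K)) = s ^+ m.+1 * c.[s^-1].
  rewrite detZ -(horner_evalE s^-1 c) -det_map_mx.
  congr (_ * \det _); apply/matrixP => a b; rewrite !mxE /=.
  by rewrite /horner_eval !hornerE hornerMn hornerX.
rewrite horner_coef size_char_poly !big_ord_recr /=.
have -> : c`_m.+1 = 1.
  by move/monicP: (char_poly_monic (- K)); rewrite lead_coefE size_char_poly.
have -> : c`_m = \tr K by rewrite (@char_poly_trace _ m.+1) // linearN opprK.
have sV l : s ^+ l * s^-1 ^+ l = 1 by rewrite -exprMn mulfV // expr1n.
have -> : s ^+ m.+1 * (\sum_(i < m) c`_i * s^-1 ^+ i + \tr K * s^-1 ^+ m
    + 1 * s^-1 ^+ m.+1)
    = s ^+ m.+1 * s^-1 ^+ m.+1 + s * \tr K * (s ^+ m * s^-1 ^+ m)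
      + s ^+ m.+1 * \sum_(i < m) c`_i * s^-1 ^+ i.
  by rewrite (exprS s m); ring.
rewrite !sV mulr1; congr (_ + _).
rewrite horner_sum !mulr_sumr; apply: eq_bigr => i _.
rewrite hornerZ hornerXn mulrCA [RHS]mulrCA; congr (_ * _).
have -> : m.+1 = (2 + (m.-1 - i) + i)%N by case: i => /= i; lia.
by rewrite !exprD -[LHS]mulrA sV mulr1.
Qed.

(** Summing up to [m.+2], not [m], leaves room for the three coefficients that
    are compared, whatever [m] is. *)
Lemma low_order_coefs (R : realFieldType) m (b : nat -> nat -> R) (c0 c2 : R)
    (p : {poly R}) :
  (forall t, \sum_(i < m.+3) \sum_(j < m.+3) t ^+ (i + j) * b i j
     = c0 + t ^+ 2 * c2 + t ^+ 3 * p.[t]) ->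
  [/\ b 0%N 0%N = c0, b 0%N 1%N + b 1%N 0%N = 0
    & b 0%N 2%N + b 1%N 1%N + b 2%N 0%N = c2].
Proof.
move=> hb.
pose P := \sum_(i < m.+3) \sum_(j < m.+3) b i j *: 'X^(i + j)
  - (c0%:P + c2 *: 'X^2 + p * 'X^3).
have P0 : P = 0.
  apply: horner_eq0_poly => t.
  rewrite /P hornerD hornerN !hornerD hornerC hornerZ hornerXn hornerM hornerXn.
  rewrite horner_sum; apply/eqP; rewrite subr_eq0; apply/eqP.
  rewrite [c2 * _]mulrC [p.[t] * _]mulrC -hb; apply: eq_bigr => i _.
  rewrite horner_sum; apply: eq_bigr => j _.
  by rewrite hornerZ hornerXn mulrC.
have coefP l : P`_l = \sum_(i < m.+3) \sum_(j < m.+3) b i j * (l == i + j)%N%:R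
    - (c0 * (l == 0)%:R + c2 * (l == 2)%:R
       + (if (l < 3)%N then 0 else p`_(l - 3))).
  rewrite coefB !coefD coefC coefZ coefXn coefMXn coef_sum.
  congr (_ - (_ + _ + _)); last by case: eqP; rewrite ?mulr1 ?mulr0.
  apply: eq_bigr => i _; rewrite coef_sum; apply: eq_bigr => j _.
  by rewrite coefZ coefXn.
have sum3 (F : nat -> R) : (forall i, (2 < i)%N -> F i = 0) ->
    \sum_(i < m.+3) F i = F 0%N + F 1%N + F 2%N.
  move=> F0; rewrite 3!big_ord_recl big1 => [|i _]; last exact: F0.
  by rewrite addr0 addrA.
have low l : (l < 3)%N ->
    \sum_(i < m.+3) \sum_(j < m.+3) b i j * (l == i + j)%N%:R
    = \sum_(i < 3) \sum_(j < 3) b i j * (l == i + j)%N%:R :> R.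
  move=> l3.
  have F0 i j : (2 < i + j)%N -> b i j * (l == i + j)%N%:R = 0 :> R.
    by case: eqP => [|_]; [lia|rewrite mulr0].
  rewrite (sum3 (fun i => \sum_(j < m.+3) b i j * (l == i + j)%N%:R)).
    2: by move=> i i2; apply: big1 => j _; apply: F0; lia.
  have inner i : \sum_(j < m.+3) b i j * (l == i + j)%N%:R
      = b i 0%N * (l == i + 0)%N%:R + b i 1%N * (l == i + 1)%N%:R
        + b i 2%N * (l == i + 2)%N%:R :> R.
    rewrite (sum3 (fun j => b i j * (l == i + j)%N%:R)) // => j j2.
    by apply: F0; lia.
  rewrite !inner.
  by rewrite !big_ord_recl !big_ord0 /= !addr0 !addrA.
split.
- have := coefP 0%N; rewrite P0 coef0 low // !big_ord_recl !big_ord0 /=.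
  by rewrite /bump /=; lra.
- have := coefP 1%N; rewrite P0 coef0 low // !big_ord_recl !big_ord0 /=.
  by rewrite /bump /=; lra.
- have := coefP 2%N; rewrite P0 coef0 low // !big_ord_recl !big_ord0 /=.
  by rewrite /bump /=; lra.
Qed.

(** * Gram matrices and orthonormal rows *)

Section Gram.
Variables (R : realType) (n : nat) (G : 'M[R]_n).

Lemma gram_mulmx m p (P : 'M[R]_(m, p)) (v : 'M[R]_(p, n)) :
  gram G (P *m v) = P *m gram G v *m P^T.
Proof. by rewrite /gram trmx_mul !mulmxA. Qed.

Lemma gram_gram m (L : 'M[R]_n) (v : 'M[R]_(m, n)) :
  gram (gram G L) v = gram G (v *m L).
Proof. by rewrite /gram trmx_mul !mulmxA. Qed.

Lemma gramDZ m (h w : 'M[R]_(m, n)) (t : R) : G^T = G -> h *m G *m w^T = 0 ->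
  gram G (h + t *: w) = gram G h + t ^+ 2 *: gram G w.
Proof.
move=> GT hw.
have wh : w *m G *m h^T = 0.
  by apply: trmx_inj; rewrite trmx0 !trmx_mul trmxK GT mulmxA.
rewrite /gram linearD /= linearZ /= !mulmxDl !mulmxDr -!scalemxAl -!scalemxAr.
by rewrite hw wh !scaler0 add0r addr0 scalerA expr2.
Qed.

Lemma mxtrace_gram m (v : 'M[R]_(m, n)) :
  \tr (gram G v) = \sum_i sqnorm G (row i v).
Proof.
rewrite /mxtrace; apply: eq_bigr => i _.
rewrite /sqnorm /gram -!row_mul ![in RHS]mxE [LHS]mxE.
by apply: eq_bigr => j _; rewrite ![trmx _ _ _]mxE [row _ _ _ _]mxE.
Qed.

Hypothesis G_inner : inner_product G.

Lemma sqnorm_ge0 u : 0 <= sqnorm G u.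
Proof.
have [->|u0] := eqVneq u 0; first by rewrite /sqnorm !mul0mx mxE.
exact/ltW/G_inner.2.
Qed.

Lemma sqnorm_eq0 u : sqnorm G u = 0 -> u = 0.
Proof.
by move=> /eqP; apply: contraTeq => /(G_inner.2) /lt0r_neq0.
Qed.

Lemma inner_product_unit : G \in unitmx.
Proof.
rewrite -row_free_unit -kermx_eq0; apply/rowV0P => u /sub_kermxP uG.
by apply: sqnorm_eq0; rewrite /sqnorm uG mul0mx mxE.
Qed.

Lemma inner_product_gram m (v : 'M[R]_(m, n)) :
  row_free v -> inner_product (gram G v).
Proof.
move=> vfree; split=> [|u u0].
  by rewrite /gram !trmx_mul trmxK G_inner.1 mulmxA.
rewrite /gram.
have -> : u *m (v *m G *m v^T) *m u^T = (u *m v) *m G *m (u *m v)^T.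
  by rewrite trmx_mul !mulmxA.
by apply: G_inner.2; rewrite mulmx_free_eq0.
Qed.

(** One Gram-Schmidt step: since [G *m w^T] has fewer than [n] columns, some
    nonzero vector is orthogonal to the rows of [w]. *)
Lemma exists_orthonormal_rows m : (m <= n)%N ->
  exists w : 'M[R]_(m, n), gram G w = 1%:M.
Proof.
elim: m => [|m IH] mn; first by exists 0; apply/matrixP => -[].
have [w ww] := IH (ltnW mn).
have : kermx (G *m w^T) != 0.
  rewrite -mxrank_eq0 mxrank_ker subn_eq0 -ltnNge.
  by apply: leq_ltn_trans mn; rewrite rank_leq_col.
case/rowV0Pn => u /sub_kermxP uw u0.
have upos : 0 < sqnorm G u by apply: G_inner.2.
pose c := (Num.sqrt (sqnorm G u))^-1.
exists (col_mx (c *: u) w : 'M[R]_(1 + m, n)).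
have wu : w *m G *m u^T = 0.
  apply: trmx_inj; rewrite trmx0 !trmx_mul trmxK G_inner.1.
  by rewrite -uw.
suff: @gram _ _ G (1 + m) (col_mx (c *: u) w) = 1%:M by [].
rewrite /gram tr_col_mx mul_col_mx mul_col_row.
rewrite -/(gram G w) ww (@scalar_mx_block _ 1 m); congr block_mx.
- apply/matrixP => i j; rewrite !ord1 linearZ /= -!scalemxAl -scalemxAr.
  rewrite scalerA mxE -expr2 exprVn sqr_sqrtr ?ltW //.
  by rewrite /sqnorm mulVf ?gt_eqF // mxE.
- by rewrite -!scalemxAl -mulmxA uw scaler0.
- by rewrite linearZ /= -scalemxAr wu scaler0.
Qed.

End Gram.

Lemma wedge_sqnorm_dependent (R : realType) n q (G : 'M[R]_n)
    (v : 'M[R]_(q, n)) : ~~ row_free v -> wedge_sqnorm G v = 0.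
Proof.
rewrite -kermx_eq0 => /rowV0Pn[c /sub_kermxP cv c0].
by apply/eqP/det0P; exists c => //; rewrite /gram !mulmxA cv !mul0mx.
Qed.

Section OrthogonalSplitting.
Variables (R : realType) (n : nat) (G : 'M[R]_n) (A : 'M[R]_n).
Hypothesis G_inner : inner_product G.

Lemma orth_complP m p (u : 'M[R]_(m, n)) (w : 'M[R]_(p, n)) :
  (u <= A)%MS -> (w <= orth_compl G A)%MS -> u *m G *m w^T = 0.
Proof.
move=> /submxP[D ->] /sub_kermxP wA.
apply: trmx_inj; rewrite trmx0 !trmx_mul trmxK G_inner.1.
by rewrite !mulmxA in wA *; rewrite wA mul0mx.
Qed.

Lemma orth_compl_capmx : (A :&: orth_compl G A = 0)%MS.
Proof.
apply/eqP/rowV0P => u; rewrite sub_capmx => /andP[uA uB].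
by apply: (sqnorm_eq0 G_inner); rewrite /sqnorm orth_complP // mxE.
Qed.

(** A dimension count: [G] is invertible, so the orthogonal complement of [A]
    has the complementary rank. *)
Lemma orth_compl_sum m (v : 'M[R]_(m, n)) : (v <= A + orth_compl G A)%MS.
Proof.
apply: submx_full; rewrite /row_full; apply/eqP.
have := mxrank_sum_cap A (orth_compl G A).
rewrite orth_compl_capmx mxrank0 addn0 => ->.
have -> : \rank (orth_compl G A) = (n - \rank A)%N.
  rewrite /orth_compl mxrank_ker; congr (_ - _)%N.
  rewrite -(mxrank_tr A) eqmxMfull // row_full_unit.
  exact: inner_product_unit G_inner.
by rewrite subnKC // rank_leq_row.
Qed.

End OrthogonalSplitting.

(** The equality property speaks of oriented planes only, so the span of
    independent vectors must be oriented before the property applies to them. *)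
Lemma exists_orientation (R : realType) n q (u0 : 'M[R]_(q, n)) :
  row_free u0 -> exists pi : oriented_plane R n q, frame pi u0.
Proof.
move=> u0free.
have or_posM (P : 'M[R]_q) (u : 'M[R]_(q, n)) :
    frame <<u0>>%MS u -> P \in unitmx ->
    (0 < \det (P *m u *m pinvmx u0))
      = ((0 < \det (u *m pinvmx u0)) == (0 < \det P)).
  rewrite /frame => /eqmxP uu0 Pu.
  have sgM (a b : R) : a != 0 -> b != 0 -> (0 < a * b) = ((0 < b) == (0 < a)).
    case: (ltgtP 0 a) => // a0 _ b0; first by rewrite pmulr_rgt0 // eqb_id.
    by rewrite nmulr_rgt0 //; case: (ltgtP 0 b) b0.
  have : \det (u *m pinvmx u0) != 0.
    rewrite -unitfE -unitmxE -row_free_unit /row_free.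
    have := mxrankMfree (u *m pinvmx u0) u0free.
    rewrite mulmxKpV; last by rewrite uu0 genmxE.
    by rewrite uu0 genmxE (eqP u0free) => <-.
  move=> d0; rewrite -mulmxA det_mulmx sgM //.
  by rewrite -unitfE -unitmxE.
have rk : \rank <<u0>>%MS = q by rewrite genmxE (eqP u0free).
(* [u *m pinvmx u0] is the change of basis from u0 to u. *)
exists (OrientedPlane rk
  (Orientation (or_pos := fun u => 0 < \det (u *m pinvmx u0)) or_posM)).
by apply/eqmxP; apply: eqmx_sym; exact: genmxE.
Qed.

Lemma sqnorm_sum (R : realType) k (G : 'M[R]_k) m (t : R)
    (u : nat -> 'rV[R]_k) :
  sqnorm G (\sum_(i < m) t ^+ i *: u i)
  = \sum_(i < m) \sum_(j < m) t ^+ (i + j) * (u i *m G *m (u j)^T) 0 0.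
Proof.
rewrite /sqnorm !mulmx_suml summxE; apply: eq_bigr => i _.
rewrite linear_sum mulmx_sumr summxE; apply: eq_bigr => j _.
by rewrite linearZ /= -!scalemxAl -scalemxAr scalerA -exprD mxE.
Qed.

(** * Tilting a plane towards the horizontal distribution *)

Section Horizontal.
Variables (R : realType) (n q : nat) (M : manifold R n).
Variables (g : riemannian_metric M) (H : smooth_distribution M q) (x : M).

Notation pH := (projH g H x).
Notation pV := (projV g H x).

Lemma projHV m (v : 'M[R]_(m, n)) : v *m pH + v *m pV = v.
Proof.
apply: add_proj_mx (orth_compl_sum _ (rm_inner g x) v).
exact: orth_compl_capmx (rm_inner g x).
Qed.

Lemma projHV_orthogonal m p (v : 'M[R]_(m, n)) (w : 'M[R]_(p, n)) :
  v *m pH *m g x *m (w *m pV)^T = 0.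
Proof.
apply: orth_complP (proj_mx_sub _ _ _) _; first exact: rm_inner.
exact: proj_mx_sub.
Qed.

Lemma projH_tilt m (v : 'M[R]_(m, n)) t :
  (v *m pH + t *: (v *m pV)) *m pH = v *m pH.
Proof.
have HV := orth_compl_capmx (H x) (rm_inner g x).
rewrite mulmxDl -scalemxAl [X in X + _](proj_mx_id HV (proj_mx_sub _ _ _)).
by rewrite [X in _ *: X](proj_mx_0 HV (proj_mx_sub _ _ _)) scaler0 addr0.
Qed.

(** The polynomial dependence on [t] in this development comes from the tilted
    frames [v *m pH + t *: (v *m pV)], which join the horizontal projection of
    [v], at [t = 0], to [v], at [t = 1]. *)
Lemma bidegree_scale (W : lmodType R) (f : 'M[R]_(q, n) -> W) i v t :
  Defs.alternating f -> bidegree g H x i f ->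
  f (v *m pH + t *: (v *m pV)) = t ^+ i *: f v.
Proof.
move=> f_alt f_bi; rewrite -[X in _ = _ *: f X]projHV.
exact: multilinear_homogeneous f_bi (proj_mx_sub _ _ _) (proj_mx_sub _ _ _).
Qed.

Variables (pi : oriented_plane R n q) (v : 'M[R]_(q, n)).
Hypothesis v_frame : frame pi v.

Lemma frame_row_free : row_free v.
Proof. by rewrite /row_free; move/eqmxP: v_frame => ->; rewrite op_rank. Qed.

Lemma frame_mulmx (P : 'M[R]_q) : P \in unitmx -> frame pi (P *m v).
Proof.
move=> Pu; apply/eqmxP; apply: eqmx_trans (eqmxP v_frame).
by apply: eqmxMfull; rewrite row_full_unit.
Qed.

Hypothesis pi_GH : inGH g H x pi.

Lemma row_free_projH : row_free (v *m pH).
Proof.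
rewrite -kermx_eq0; apply/rowV0P => c /sub_kermxP cv.
apply/eqP; rewrite -(mulmx_free_eq0 _ frame_row_free); apply/eqP.
apply: pi_GH; rewrite ?sub0mx ?mul0mx -?mulmxA //.
by move/eqmxP: v_frame => <-; apply: submxMl.
Qed.

(** [ve] picks a basis by choice, with a junk default, so it has its meaning
    only once some orthonormal basis is known to exist. *)
Lemma exists_orthonormal_frame : exists2 P : 'M[R]_q,
  P \in unitmx & orthonormal_basis (gH g H x) pi (P *m v).
Proof.
have [P PP] := exists_orthonormal_rows
  (inner_product_gram (rm_inner g x) row_free_projH) (leqnn q).
have Pu : P \in unitmx by rewrite -unitmx_tr; case: (mulmx1_unit PP).
exists P => //; rewrite /orthonormal_basis frame_mulmx //=.
by apply/eqP; rewrite /gH gram_gram -mulmxA gram_mulmx.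
Qed.

Lemma wedge_sqnorm_gH_gt0 : 0 < wedge_sqnorm (gH g H x) v.
Proof.
have [P Pu /andP[_ /eqP]] := exists_orthonormal_frame.
rewrite gram_mulmx => /(congr1 determinant).
rewrite !det_mulmx det_tr det1 -/(wedge_sqnorm _ _) => D1.
have : 0 < (\det P ^+ 2) * wedge_sqnorm (gH g H x) v.
  by rewrite expr2 mulrAC D1.
by rewrite pmulr_rgt0 // exprn_even_gt0 //= -unitfE -unitmxE.
Qed.

Lemma volH_sqr : `|volH g H x pi v| ^+ 2 = wedge_sqnorm (gH g H x) v.
Proof.
rewrite real_normK ?num_real // /volH /volume_form exprMn.
rewrite sqr_sqrtr ?ltW ?wedge_sqnorm_gH_gt0 //.
by case: ifP => _; rewrite ?sqrrN expr1n mul1r.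
Qed.

Lemma volH_gt0 : op_or pi v -> 0 < volH g H x pi v.
Proof.
move=> piv; rewrite /volH /volume_form piv mul1r sqrtr_gt0.
exact: wedge_sqnorm_gH_gt0.
Qed.

(** In a basis orthonormal for [gH] the Gram matrix of the tilted frame is
    [1%:M + t ^+ 2 *: K], because horizontal and vertical parts are orthogonal,
    and [\tr K] is the sum of squares that defines twice the vertical energy.
    The factor [wedge_sqnorm (gH g H x) v] comes from the change of basis. *)
Lemma wedge_sqnorm_expansion : exists p : {poly R}, forall t,
  wedge_sqnorm (g x) (v *m pH + t *: (v *m pV))
  = wedge_sqnorm (gH g H x) v
    + t ^+ 2 * (wedge_sqnorm (gH g H x) v * (2 * ve g H x pi))
    + t ^+ 3 * p.[t].
Proof.
have [P Pu wo] := exists_orthonormal_frame.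
set w := P *m v in wo; pose Q := invmx P.
have vw : v = Q *m w by rewrite /w mulmxA mulVmx // mul1mx.
pose K := gram (g x) (w *m pV).
have trK : \tr K = 2 * ve g H x pi.
  rewrite (ve_basis wo) /vertical_energy mulrA mulfV ?pnatr_eq0 // mul1r.
  by rewrite mxtrace_gram; apply: eq_bigr => i _; rewrite row_mul.
case/andP: wo => _ /eqP ow.
have DQ : wedge_sqnorm (gH g H x) v = \det Q * \det Q.
  by rewrite /wedge_sqnorm vw gram_mulmx ow mulmx1 det_mulmx det_tr.
have [p pE] := det_1DZ K.
exists (wedge_sqnorm (gH g H x) v *: ('X * (p \Po 'X^2))) => t.
have -> : wedge_sqnorm (g x) (v *m pH + t *: (v *m pV))
    = wedge_sqnorm (gH g H x) v * \det (1%:M + t ^+ 2 *: K).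
  rewrite {1}/wedge_sqnorm gramDZ ?(rm_inner g x).1 ?projHV_orthogonal //.
  rewrite -gram_gram -/(gH g H x) {2}vw -mulmxA !(gram_mulmx _ Q) -/K.
  rewrite [in gram _ v]vw gram_mulmx ow.
  rewrite scalemxAl scalemxAr -mulmxDl -mulmxDr !det_mulmx det_tr DQ.
  by rewrite mulrAC.
rewrite pE trK hornerZ hornerM hornerX horner_comp hornerXn.
by ring.
Qed.

End Horizontal.

(** * The second-order identity *)

Section SecondOrder.
Variables (R : realType) (n q k : nat) (M : manifold R n).
Variables (g : riemannian_metric M) (E : vector_bundle M k).
Variables (gE : bundle_metric E) (alpha : diff_form M q).
Variables (chi : bundle_form E q) (H : smooth_distribution M q).
Variables (o : forall x, orientation q (H x)).
Variables (alpha_ : nat -> diff_form M q) (chi_ : nat -> bundle_form E q).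
Hypothesis alpha_chi : equality_property g gE alpha chi.
Hypothesis alpha_H : calibrated g alpha o.
Hypothesis alphaE : hv_decomposition g H alpha alpha_.
Hypothesis chiE : hv_decomposition_bundle g H chi chi_.

Lemma component_expansion (x : M) (v : 'M[R]_(q, n)) t :
  alpha x (v *m projH g H x + t *: (v *m projV g H x))
  = \sum_(i < q.+3) t ^+ i * alpha_ i x v.
Proof.
case: alphaE => bi zero ->; rewrite [RHS]big_ord_recr [in RHS]big_ord_recr /=.
rewrite !zero // !mulr0 !addr0; apply: eq_bigr => i _.
exact: (bidegree_scale (W := R^o) v t (df_alt (alpha_ i) x) (bi i x)).
Qed.

Lemma component_expansion_bundle (x : M) (v : 'M[R]_(q, n)) t :
  chi x (v *m projH g H x + t *: (v *m projV g H x))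
  = \sum_(i < q.+3) t ^+ i *: chi_ i x v.
Proof.
case: chiE => bi zero ->; rewrite [RHS]big_ord_recr [in RHS]big_ord_recr /=.
rewrite !zero // !scaler0 !addr0; apply: eq_bigr => i _.
exact: (bidegree_scale v t (bf_alt (chi_ i) x) (bi i x)).
Qed.

(** The tilted frame at [t = 0] is the horizontal projection, on which only the
    component of index [0] contributes and where the calibration is known. *)
Lemma component0E (x : M) v : alpha_ 0%N x v
  = volume_form (g x) (o x) (v *m projH g H x).
Proof.
rewrite -alpha_H; last exact: proj_mx_sub.
have := component_expansion x v 0; rewrite scale0r addr0 => ->.
rewrite big_ord_recl expr0 mul1r big1 ?addr0 // => i _.
by rewrite expr0n mul0r.
Qed.

Variables (x : M) (pi : oriented_plane R n q) (v : 'M[R]_(q, n)).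
Hypothesis v_frame : frame pi v.
Hypothesis pi_GH : inGH g H x pi.

(** The tilted frames all have the same, independent, horizontal projection:
    they span [q]-planes, to which the equality property applies, for every
    [t]. *)
Lemma equality_property_expansion t :
  \sum_(i < q.+3) \sum_(j < q.+3) t ^+ (i + j)
     * (alpha_ i x v * alpha_ j x v
        + (chi_ i x v *m gE x *m (chi_ j x v)^T) 0 0)
  = wedge_sqnorm (g x) (v *m projH g H x + t *: (v *m projV g H x)).
Proof.
set vt := v *m projH g H x + _.
have vt_free : row_free vt.
  rewrite -kermx_eq0; apply/rowV0P => c /sub_kermxP cv.
  apply/eqP; rewrite -(mulmx_free_eq0 _ (row_free_projH v_frame pi_GH)).
  by rewrite -(projH_tilt g H x v t) mulmxA cv mul0mx.
have [pi' vt_frame] := exists_orientation vt_free.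
rewrite -(alpha_chi x vt_frame) component_expansion component_expansion_bundle.
rewrite (sqnorm_sum _ _ _ (fun i => chi_ i x v)) expr2 mulr_suml -big_split.
apply: eq_bigr => i _ /=.
rewrite mulr_sumr -big_split; apply: eq_bigr => j _ /=.
by rewrite mulrDr exprD; ring.
Qed.

(** Comparing coefficients of the two expansions in [t].  In degree 0, where
    [alpha_ 0] already accounts for the whole volume, [chi_ 0] must vanish; in
    degree 1 this leaves [alpha_ 0 * alpha_ 1 = 0], so [alpha_ 1] vanishes;
    hence degree 2 has no cross terms other than [alpha_ 0 * alpha_ 2]. *)
Lemma second_order_identity :
  alpha_ 0%N x v * alpha_ 2%N x v + 2^-1 * sqnorm (gE x) (chi_ 1%N x v)
  = `|volH g H x pi v| ^+ 2 * ve g H x pi.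
Proof.
set D := wedge_sqnorm (gH g H x) v.
have D0 : 0 < D := wedge_sqnorm_gH_gt0 v_frame pi_GH.
have [p pE] := wedge_sqnorm_expansion v_frame pi_GH.
have [] := low_order_coefs (b := fun i j => alpha_ i x v * alpha_ j x v
    + (chi_ i x v *m gE x *m (chi_ j x v)^T) 0 0) (fun t =>
  etrans (equality_property_expansion t) (pE t)).
have a0 : alpha_ 0%N x v ^+ 2 = D.
  rewrite component0E /volume_form exprMn sqr_sqrtr.
    rewrite /wedge_sqnorm -gram_gram -/(gH g H x).
    by case: ifP => _; rewrite ?sqrrN expr1n mul1r.
  by rewrite /wedge_sqnorm -gram_gram ltW.
rewrite -expr2 a0 -/D => /eqP.
rewrite -subr_eq0 addrAC subrr add0r => /eqP.
move=> /(sqnorm_eq0 (bm_inner gE x)) ->.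
rewrite trmx0 !mulmx0 !mul0mx [(0 : 'M[R]_1) _ _]mxE !addr0.
rewrite (mulrC (alpha_ 1%N x v)) -mulr2n => /eqP.
rewrite mulrn_eq0 /= mulf_eq0 => /orP[/eqP z|/eqP ->].
  by move: D0; rewrite -a0 z expr0n ltxx.
rewrite mul0r add0r -/(sqnorm _ _) volH_sqr // -/D => c2.
move: c2; lra.
Qed.

Hypothesis pi_GHplus : inGHplus g o x pi.

Lemma component0_positive :
  positive_frame (op_or pi) v -> alpha_ 0%N x v = volH g H x pi v.
Proof.
move=> v_pos; have [_ _ /(_ v v_pos)/andP[_ ov]] := pi_GHplus.
have /andP[_ piv] := v_pos.
rewrite component0E /volH /volume_form ov piv.
by rewrite /wedge_sqnorm -gram_gram.
Qed.

(** Negative frames become positive when their first vector is reversed, on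
    [pi] and on [H] simultaneously.  A point has no vector to reverse, whence
    [0 < q]. *)
Lemma component0_frame : (0 < q)%N -> alpha_ 0%N x v = volH g H x pi v.
Proof.
move=> q0; have [piv|piv] := boolP (op_or pi v).
  by apply: component0_positive; rewrite /positive_frame v_frame.
pose P : 'M[R]_q := diag_mx (\row_i (if i == Ordinal q0 then -1 else 1)).
have detP : \det P = -1.
  rewrite det_diag (bigD1 (Ordinal q0)) //= mxE eqxx big1 ?mulr1 // => i.
  by rewrite mxE => /negPf ->.
have Pu : P \in unitmx by rewrite unitmxE detP unitrN1.
have negP : (0 < \det P) = false by rewrite detP oppr_gt0 ltr10.
have [_ /eqmxP pi_H pos] := pi_GHplus.
have vH_frame : frame (H x) (v *m projH g H x).
  by apply/eqmxP; apply: eqmx_trans pi_H; apply: eqmxMr; exact/eqmxP.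
have /pos/andP[_] : positive_frame (op_or pi) (P *m v).
  by rewrite /positive_frame frame_mulmx //= or_posM // (negPf piv) negP.
rewrite -mulmxA or_posM // negP eqbF_neg => /negPf oH.
rewrite component0E /volH /volume_form oH (negPf piv).
by rewrite /wedge_sqnorm -gram_gram.
Qed.

End SecondOrder.

Unset Implicit Arguments.

Theorem corollary5p7 (R : realType) (q r k : nat)
  (M : manifold R (q + r)) (g : riemannian_metric M)
  (E : vector_bundle M k) (gE : bundle_metric E)
  (alpha : diff_form M q) (chi : bundle_form E q)
  (H : smooth_distribution M q) (o : forall x, orientation q (H x))
  (alpha_ : nat -> diff_form M q) (chi_ : nat -> bundle_form E q) :
  semi_calibration g alpha ->
  equality_property g gE alpha chi ->
  calibrated g alpha o ->
  hv_decomposition g H alpha alpha_ ->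
  hv_decomposition_bundle g H chi chi_ ->
  (forall (x : M) (pi : oriented_plane R (q + r) q) (v : 'M[R]_(q, q + r)),
     inGH g H x pi -> frame pi v ->
     alpha_ 0%N x v * alpha_ 2%N x v + 2^-1 * sqnorm (gE x) (chi_ 1%N x v)
       = `|volH g H x pi v| ^+ 2 * ve g H x pi)
  /\
  (forall (x : M) (pi : oriented_plane R (q + r) q),
     inGHplus g o x pi ->
     [/\ forall v : 'M[R]_(q, q + r),
           orthonormal_basis (gH g H x) pi v ->
           positive_frame (op_or pi) v ->
           alpha_ 2%N x v + 2^-1 * sqnorm (gE x) (chi_ 1%N x v) = ve g H x pi,
         forall v : 'M[R]_(q, q + r),
           positive_frame (op_or pi) v ->
           alpha_ 2%N x v <= ve g H x pi * volH g H x pi v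
       & (forall v : 'M[R]_(q, q + r), (v <= pi)%MS ->
            alpha_ 2%N x v = ve g H x pi * volH g H x pi v)
         <-> (forall v : 'M[R]_(q, q + r), (v <= pi)%MS ->
                chi_ 1%N x v = 0)]).
Proof.
move=> _ alpha_chi alpha_H alphaE chiE.
have part1 x pi v := second_order_identity alpha_chi alpha_H alphaE chiE
  (x := x) (pi := pi) (v := v).
split=> [x pi v pi_GH v_frame|x pi pi_GHplus]; first exact: part1.
have [pi_GH _ _] := pi_GHplus.
(* In this form the identity can be divided by the volume. *)
have part1_vol (v : 'M[R]_(q, q + r)) : frame pi v ->
    alpha_ 0%N x v = volH g H x pi v ->
    volH g H x pi v * alpha_ 2%N x v + 2^-1 * sqnorm (gE x) (chi_ 1%N x v)
    = volH g H x pi v * (ve g H x pi * volH g H x pi v).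
  move=> v_frame a0; rewrite -[X in X * alpha_ _ _ _ + _]a0 (part1 x pi) //.
  by rewrite real_normK ?num_real //; ring.
have a0_pos := component0_positive alpha_H alphaE pi_GHplus.
have a0_frame := component0_frame alpha_H alphaE _ pi_GHplus.
split=> [v v_on v_pos|v v_pos|].
- have /andP[v_frame /eqP v1] := v_on; have [_ piv] := andP v_pos.
  have vol1 : volH g H x pi v = 1.
    by rewrite /volH /volume_form piv mul1r /wedge_sqnorm v1 det1 sqrtr1.
  by have := part1_vol v v_frame (a0_pos v v_pos); rewrite vol1 mulr1 !mul1r.
- have [v_frame piv] := andP v_pos.
  rewrite -(ler_pM2l (volH_gt0 v_frame pi_GH piv)).
  rewrite -part1_vol ?a0_pos // lerDl mulr_ge0 ?invr_ge0 ?ler0n //.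
  exact: sqnorm_ge0 (bm_inner gE x) _.
(* For q = 0 every term vanishes, whatever the two orientations are. *)
have [q0|q_gt0] := posnP q.
  have a2 v : alpha_ 2%N x v = 0 by case: alphaE => _ -> //; rewrite q0.
  have chi1 v : chi_ 1%N x v = 0 by case: chiE => _ -> //; rewrite q0.
  have ve0 : ve g H x pi = 0.
    rewrite /ve /vertical_energy big1 ?mulr0 // => i _.
    by have := ltn_ord i; rewrite {2}q0.
  by split=> _ v _; rewrite ?a2 ?ve0 ?mul0r.
have frame_or_dep (v : 'M[R]_(q, q + r)) : (v <= pi)%MS ->
    frame pi v \/ ~~ row_free v.
  move=> v_pi; have [vfree|] := boolP (row_free v); [left|by right].
  rewrite /frame -(geq_leqif (mxrank_leqif_eq v_pi)) op_rank.
  by rewrite (eqP vfree).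
split=> eqn v v_pi.
- have [v_frame|] := frame_or_dep v v_pi; last first.
    exact: alternating_dependent (bf_alt (chi_ 1%N) x) _.
  have := part1_vol v v_frame (a0_frame v v_frame q_gt0); rewrite eqn //.
  move/eqP; rewrite addrC -subr_eq0 addrK mulf_eq0 invr_eq0 pnatr_eq0 /=.
  by move/eqP/(sqnorm_eq0 (bm_inner gE x)).
- have [v_frame|v_dep] := frame_or_dep v v_pi; last first.
    rewrite /volH /volume_form wedge_sqnorm_dependent // sqrtr0 !mulr0.
    exact: (alternating_dependent (W := R^o) (df_alt (alpha_ 2%N) x) v_dep).
  have := part1_vol v v_frame (a0_frame v v_frame q_gt0).
  rewrite eqn // /sqnorm !mul0mx mxE mulr0 addr0; apply: mulfI.
  have := wedge_sqnorm_gH_gt0 v_frame pi_GH.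
  rewrite -(volH_sqr v_frame pi_GH).
  by apply: contraTneq => ->; rewrite normr0 expr0n ltxx.
Qed.
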